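(* Let $m \ge n \ge 2$ and let $L : M_{m,n} \to M_{m,n}$ be an invertible linear map such that $L(S(\mathbb{R}^n_+,\mathbb{R}^m_+)) \subset S(\mathbb{R}^n_+,\mathbb{R}^m_+)$. Then there exist an invertible row positive matrix $X \in M_m$ and an inverse nonnegative matrix $Y \in M_n$ such that $L(A) = XAY$ for all $A \in M_{m,n}$.
   Context: $M_{m,n}$ is the space of real $m\times n$ matrices and $M_n = M_{n,n}$. $\mathbb{R}^n_+$ is the nonnegative orthant in $\mathbb{R}^n$. A matrix $A\in M_{m,n}$ is semipositive if there is $x \in \mathbb{R}^n$ with $x>0$ and $Ax>0$ (componentwise strict inequalities); $S(\mathbb{R}^n_+,\mathbb{R}^m_+)$ denotes the set of all semipositive $m\times n$ matrices. A matrix is row positive if it is entrywise nonnegative and every row contains at least one nonzero entry. A square matrix $Y$ is inverse nonnegative if it is invertible and $Y^{-1}$ is entrywise nonnegative. *)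

(* Defs.v *)
From mathcomp Require Import all_boot all_order all_algebra.
From mathcomp Require Import reals.

Set Implicit Arguments.
Unset Strict Implicit.
Unset Printing Implicit Defensive.

Import Order.TTheory GRing.Theory Num.Theory.
Local Open Scope ring_scope.

Definition mx_pos (R : realType) (m n : nat) (A : 'M[R]_(m, n)) : Prop :=
  forall i j, 0 < A i j.

Definition mx_nonneg (R : realType) (m n : nat) (A : 'M[R]_(m, n)) : Prop :=
  forall i j, 0 <= A i j.

Definition semipositive (R : realType) (m n : nat) (A : 'M[R]_(m, n)) : Prop :=
  exists x : 'cV[R]_n, mx_pos x /\ mx_pos (A *m x).

Definition row_positive (R : realType) (m n : nat) (A : 'M[R]_(m, n)) : Prop :=
  mx_nonneg A /\ forall i, exists j, A i j != 0.

(* The conjunct [Y \in unitmx] is needed: [invmx Y] is [Y] itself when [Y] is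
   singular. *)
Definition inverse_nonnegative (R : realType) (n : nat) (Y : 'M[R]_n) : Prop :=
  Y \in unitmx /\ mx_nonneg (invmx Y).

(* Main.v *)
Require Import Defs.
From mathcomp Require Import all_boot all_order all_algebra.
From mathcomp Require Import reals boolp.

Set Implicit Arguments.
Unset Strict Implicit.
Unset Printing Implicit Defensive.

Import Order.TTheory GRing.Theory Num.Theory.
Local Open Scope ring_scope.

(** The set of semipositive matrices is a union of open convex cones
    [{A | A x > 0}], so by duality the hypothesis on [L] is a statement on
    rank-one functionals. Fix nonnegative nonzero [y] and [x]. No matrix [A] can
    satisfy both [A x > 0] and [y L(A) < 0], since the first makes [A], hence
    [L(A)], semipositive. Gordan's theorem of the alternative ([gordan]) then
    yields nonnegative [z], [u] with [y L(A) u = z A x] for every [A], and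
    bijectivity of [L] forces [z] to be nonzero ([rank_one_pullback]).

    The rest is linear algebra on these identities, and the same
    overdetermination is used twice. For fixed [y], take for [x] the standard
    basis vectors and their sum [1]. The [n] vectors [u_j] attached to the basis
    are independent, and expanding the vector attached to [1] along them shows
    that the rows [z_j] are all positive multiples of a single row [z]. After
    rescaling, [y L(A) V = z A] with [V] invertible and nonnegative
    ([column_pullback]).

    Then take for [y] the standard basis rows and their sum. This gives
    [row_i (L A) V_i = z_i A] and [1 L(A) V = z A]. The rows [z_i] form an
    invertible matrix [Z] because [L] is injective, and comparing the sum of the
    first identities with the second gives [V = a_i V_i], where [a_i] are the
    coordinates of [z] in the [z_i]. They are positive since [V] and [V_i]
    are nonnegative. Hence [L A = (diag(a) Z) A V^-1]. *)

(** * Perturbation and positivity *)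

Lemma mx_pos_perturb (R : realType) (p q : nat) (a b : 'M[R]_(p, q)) :
  mx_pos a -> exists2 e : R, 0 < e & mx_pos (a + e *: b).
Proof.
(* The step (1 + s)^-1 makes e |b i j| < a i j for every entry at once. *)
move=> a_gt0; pose s := \sum_i \sum_j `|b i j| / a i j.
have t_ge0 i j : 0 <= `|b i j| / a i j.
  by rewrite divr_ge0 // ltW.
have s_ge0 : 0 <= s by apply: sumr_ge0 => i _; apply: sumr_ge0.
have s1_gt0 : 0 < 1 + s by rewrite ltr_pwDl.
exists (1 + s)^-1 => [|i j]; first by rewrite invr_gt0.
have le_s : `|b i j| / a i j <= s.
  rewrite /s (bigD1 i) //= (bigD1 j) //= -addrA lerDl.
  by rewrite addr_ge0 ?sumr_ge0 // => k _; rewrite sumr_ge0.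
have: `|b i j| < a i j * (1 + s).
  rewrite mulrC -ltr_pdivrMr //; apply: le_lt_trans le_s _.
  by rewrite ltrDr ltr01.
rewrite -ltr_pdivrMr // => lt_a.
rewrite !mxE mulrC -[_ / _]opprK subr_gt0 -mulNr.
apply: le_lt_trans lt_a; rewrite ler_pM2r ?invr_gt0 //.
by rewrite -normrN ler_norm.
Qed.

(** Since [A x > 0] is an open condition, the positivity of the witness [x] can
    be relaxed to nonnegativity. This makes the standard basis vectors available
    as witnesses, without a limiting argument. *)
Lemma semipositive_nonneg (R : realType) (m n : nat) (A : 'M[R]_(m, n))
    (x : 'cV[R]_n) :
  mx_nonneg x -> mx_pos (A *m x) -> semipositive A.
Proof.
move=> x_ge0 Ax_gt0.
have [e e_gt0 pos] := mx_pos_perturb (A *m const_mx 1) Ax_gt0.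
exists (x + e *: const_mx 1); split=> [i j|].
  by rewrite !mxE mulr1 ltr_wpDl.
by rewrite mulmxDr -scalemxAr.
Qed.

Lemma pos_factor (R : realType) (a b : R) : 0 <= b -> 0 < a * b -> 0 < a.
Proof.
rewrite le0r => /orP[/eqP->|b_gt0]; first by rewrite mulr0 ltxx.
by rewrite pmulr_lgt0.
Qed.

Lemma nonneg_neq0_mul_pos (R : realType) (n : nat) (y : 'rV[R]_n)
    (c : 'cV[R]_n) :
  mx_nonneg y -> y != 0 -> mx_pos c -> 0 < (y *m c) 0 0.
Proof.
move=> y_ge0 /rV0Pn[j yj] c_gt0; rewrite mxE (bigD1 j) //=.
apply: ltr_pwDl; first by rewrite mulr_gt0 // lt_def yj y_ge0.
by apply: sumr_ge0 => k _; rewrite mulr_ge0 ?y_ge0 // ltW.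
Qed.

(** * A theorem of the alternative *)

(** Gordan's theorem, by induction on the number of coordinates. Split [f] into
    its first coordinate [h] and the others [g], and take [w] with [g w > 0].
    The case [h w > 0] is immediate, and [h w = 0] follows by perturbing [w].
    If [h w < 0], subtracting from any [v] the multiple of [w] that cancels
    [h v] amounts to replacing [g] by a combination [g + h c] with [c > 0], so
    that a nonnegative relation [z] among the coordinates of [g + h c] is one
    among those of [f], with coefficient [z c] on [h]. Stating it for maps on an
    arbitrary module allows [w] to be a matrix. *)
Lemma gordan (R : realType) (W : lmodType R) (p : nat) (f : W -> 'cV[R]_p) :
  linear f ->
  (exists w, mx_pos (f w)) \/
  (exists z : 'rV[R]_p, [/\ mx_nonneg z, z != 0 & forall w, z *m f w = 0]).
Proof.
elim: p f => [|p IHp] f lin_f; first by left; exists 0 => -[].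
pose h w : R := f w ord0 ord0.
pose g w : 'cV_p := dsubmx (f w : 'cV_(1 + p)).
have fE w : f w = col_mx (h w)%:M (g w) :> 'cV_(1 + p).
  rewrite -[LHS](@vsubmxK _ 1 p 1); congr col_mx.
  by rewrite [LHS]mx11_scalar mxE; congr ((f w _ _)%:M); apply: val_inj.
have lin_h a u v : h (a *: u + v) = a * h u + h v by rewrite /h lin_f !mxE.
have hZ a u : h (a *: u) = a * h u.
  have h0 : h 0 = 0.
    by have := lin_h (-1) 0 0; rewrite scaler0 addr0 mulN1r addNr.
  by rewrite -[in LHS](addr0 (a *: u)) lin_h h0 addr0.
have lin_g : linear g.
  by move=> a u v; apply/matrixP=> i j; rewrite !mxE lin_f !mxE.
have pos_f w : 0 < h w -> mx_pos (g w) -> mx_pos (f w).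
  move=> h_gt0 g_gt0; rewrite fE => i j; rewrite (@mxE _ (1 + p) 1) /=.
  by case: split => k; rewrite ?g_gt0 // mxE !ord1 eqxx.
have mul_f (b : R) (z : 'rV_p) w :
    row_mx b%:M z *m f w = (b * h w)%:M + z *m g w.
  by rewrite fE (@mul_row_col _ 1 1 p 1) -scalar_mxM.
have nneg (b : R) (z : 'rV_p) : 0 <= b -> mx_nonneg z ->
    mx_nonneg (row_mx b%:M z : 'rV_(1 + p)).
  move=> b_ge0 z_ge0 i j; rewrite mxE; case: split => k; rewrite ?z_ge0 //.
  by rewrite mxE !ord1 eqxx.
(* A point where h vanishes can be moved to where h is positive, unless h is
   identically zero, which is itself a relation. *)
have boundary w : h w = 0 -> mx_pos (g w) ->
    (exists w, mx_pos (f w)) \/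
    (exists z : 'rV[R]_p.+1,
       [/\ mx_nonneg z, z != 0 & forall w, z *m f w = 0]).
  move=> hw0 g_gt0.
  have [[v hv]|h0] := pselect (exists v, h v != 0); last first.
    right; exists (row_mx 1%:M 0 : 'rV_(1 + p)); split.
    - by apply: nneg => // i j; rewrite mxE.
    - apply/eqP=> /(congr1 (fun z : 'rV_(1 + p) => lsubmx z 0 0)).
      by rewrite row_mxKl !mxE => /eqP; rewrite oner_eq0.
    move=> v; rewrite mul_f mul0mx addr0 mul1r.
    have [->|hv] := eqVneq (h v) 0; first by rewrite -scalemx1 scale0r.
    by case: h0; exists v.
  left; have [e e_gt0 pos] := mx_pos_perturb (g ((h v)^-1 *: v)) g_gt0.
  exists (e *: ((h v)^-1 *: v) + w); apply: pos_f.
    by rewrite lin_h hw0 addr0 hZ mulVf // mulr1.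
  by rewrite lin_g addrC.
have [[w g_gt0]|[z [z_ge0 z_neq0 zg]]] := IHp g lin_g; last first.
  right; exists (row_mx 0%:M z : 'rV_(1 + p)); split; first exact: nneg.
    apply: contra_neq z_neq0 => z0; rewrite -[z](@row_mxKr _ 1 1 p 0%:M).
    by rewrite z0 linear0.
  by move=> w; rewrite mul_f zg mul0r addr0 -scalemx1 scale0r.
have [h_lt0|h_gt0|h0] := ltgtP (h w) 0; last exact: (boundary w).
  (* On ker h the map g' is g, and g' kills w. *)
  pose c := - (h w)^-1 *: g w.
  have c_gt0 : mx_pos c.
    by move=> i j; rewrite mxE mulr_gt0 // oppr_gt0 invr_lt0.
  pose g' v := g v + h v *: c.
  have lin_g' : linear g'.
    move=> a u v; rewrite /g' lin_g lin_h scalerDl scalerDr.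
    by rewrite -[(a * _) *: _]scalerA addrACA.
  have [[v g'_gt0]|[z [z_ge0 z_neq0 zg']]] := IHp g' lin_g'.
    apply: (boundary (- (h v / h w) *: w + v)).
      by rewrite lin_h mulNr divfK ?ltr0_neq0 // addNr.
    rewrite lin_g; suff -> : - (h v / h w) *: g w + g v = g' v by [].
    by rewrite /g' /c scalerA mulrN addrC.
  right; exists (row_mx ((z *m c) 0 0)%:M z : 'rV_(1 + p)); split.
  - by apply: nneg => //; rewrite ltW // nonneg_neq0_mul_pos.
  - apply: contra_neq z_neq0 => z0.
    by rewrite -[z](@row_mxKr _ 1 1 p ((z *m c) 0 0)%:M) z0 linear0.
  move=> v; rewrite mul_f mulrC scalar_mxM -mx11_scalar mul_scalar_mx.
  by rewrite scalemxAr -mulmxDr addrC zg'.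
by left; exists w; apply: pos_f.
Qed.

(** * Rank-one functionals *)

Lemma delta_mx_nonneg (R : realType) (p q : nat) (i : 'I_p) (j : 'I_q) :
  mx_nonneg (delta_mx i j : 'M[R]_(p, q)).
Proof. by move=> k l; rewrite mxE ler0n. Qed.

Lemma delta_mx_neq0 (R : realType) (p q : nat) (i : 'I_p) (j : 'I_q) :
  delta_mx i j != 0 :> 'M[R]_(p, q).
Proof. by apply/matrix0Pn; exists i, j; rewrite mxE !eqxx oner_eq0. Qed.

Lemma const_mx1_nonneg (R : realType) (p q : nat) :
  mx_nonneg (const_mx 1 : 'M[R]_(p, q)).
Proof. by move=> i j; rewrite mxE. Qed.

Lemma const_mx1_neq0 (R : realType) (p q : nat) (i : 'I_p) (j : 'I_q) :
  const_mx 1 != 0 :> 'M[R]_(p, q).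
Proof. by apply/matrix0Pn; exists i, j; rewrite mxE oner_eq0. Qed.

(** A nonzero row has a right inverse, so [y *m A] runs over all rows as [A]
    varies. *)
Lemma mulmx_arbitrary_eq0 (R : realType) (m n p : nat) (y : 'rV[R]_m)
    (U : 'M[R]_(n, p)) :
  y != 0 -> (forall A : 'M_(m, n), y *m A *m U = 0) -> U = 0.
Proof.
move=> y_neq0 yAU; apply/row_matrixP=> i.
have y_free : row_free y by rewrite /row_free rank_rV y_neq0.
have := yAU (pinvmx y *m delta_mx 0 i).
by rewrite mulmxA mulmxVp // mul1mx -rowE row0.
Qed.

(** The dual form of the preservation hypothesis: the adjoint of [L] sends some
    rank-one matrix with left factor [y] to a rank-one matrix with right factor
    [x]. The strict system [A x > 0, y L(A) < 0] is infeasible because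
    [y L(A) v] would be both positive and nonpositive at a witness [v] of the
    semipositivity of [L A]. *)
Lemma rank_one_pullback (R : realType) (m n : nat)
    (L : {linear 'M[R]_(m, n) -> 'M[R]_(m, n)})
    (L_inv : bijective L)
    (L_semipos : forall A : 'M[R]_(m, n), semipositive A -> semipositive (L A))
    (y : 'rV[R]_m) (x : 'cV[R]_n) :
    mx_nonneg y -> y != 0 -> mx_nonneg x -> x != 0 ->
  exists (z : 'rV[R]_m) (u : 'cV[R]_n),
    [/\ mx_nonneg z, z != 0, mx_nonneg u
      & forall A, y *m L A *m u = z *m A *m x].
Proof.
move=> y_ge0 y_neq0 x_ge0 x_neq0.
pose f A := col_mx (A *m x) (- (y *m L A)^T).
have lin_f : linear f.
  move=> a A B; rewrite /f linearP mulmxDl mulmxDr -scalemxAl -scalemxAr.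
  by rewrite scale_col_mx add_col_mx linearP opprD scalerN.
have [[A /= fA]|[z [z_ge0 z_neq0 zf]]] := gordan lin_f.
  have Ax : mx_pos (A *m x).
    by move=> i j; have := fA (lshift n i) j; rewrite col_mxEu.
  have [v [v_gt0 LAv]] := L_semipos _ (semipositive_nonneg x_ge0 Ax).
  have := nonneg_neq0_mul_pos y_ge0 y_neq0 LAv.
  rewrite mulmxA mxE ltNge sumr_le0 // => k _.
  rewrite mulr_le0_ge0 //; last exact: ltW.
  by have := fA (rshift m k) 0; rewrite col_mxEd !mxE oppr_gt0 => /ltW.
have LE A : y *m L A *m (rsubmx z)^T = lsubmx z *m A *m x.
  have := zf A; rewrite -{1}[z]hsubmxK mul_row_col mulmxN mulmxA.
  move/subr0_eq => ->; rewrite [RHS]mx11_scalar -tr_scalar_mx -mx11_scalar.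
  by rewrite trmx_mul trmxK.
exists (lsubmx z), (rsubmx z)^T.
split=> //; [by move=> i j; rewrite mxE | | by move=> i j; rewrite !mxE].
apply: contra_neq z_neq0 => z0.
suff u0 : (rsubmx z)^T = 0.
  by rewrite -[z]hsubmxK z0 -[rsubmx z]trmxK u0 trmx0 row_mx0.
(* If z vanished, the relation would be y *m B *m u = 0 for all B = L A. *)
have [K LK KL] := L_inv.
apply: (mulmx_arbitrary_eq0 y_neq0) => A.
by rewrite -[A]KL LE z0 !mul0mx.
Qed.

(** The row [z] of [rank_one_pullback] may be chosen independently of [x]: the
    rows obtained for the standard basis vectors must all be proportional to the
    one obtained for their sum, and the proportionality factors are absorbed in
    the columns of [V]. *)
Lemma column_pullback (R : realType) (m n : nat)
    (L : {linear 'M[R]_(m, n) -> 'M[R]_(m, n)})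
    (L_inv : bijective L)
    (L_semipos : forall A : 'M[R]_(m, n), semipositive A -> semipositive (L A))
    (y : 'rV[R]_m) :
    mx_nonneg y -> y != 0 -> (0 < n)%N ->
  exists (z : 'rV[R]_m) (V : 'M[R]_n),
    [/\ mx_nonneg z, z != 0, mx_nonneg V, V \in unitmx
      & forall A, y *m L A *m V = z *m A].
Proof.
move=> y_ge0 y_neq0 n_gt0.
have /fin_all_exists[zz /fin_all_exists[uu zuP]] j :=
  rank_one_pullback L_inv L_semipos y_ge0 y_neq0
    (delta_mx_nonneg R j ord0) (delta_mx_neq0 R j ord0).
have [z [u [z_ge0 z_neq0 u_ge0 zuE]]] :=
  rank_one_pullback L_inv L_semipos y_ge0 y_neq0
    (@const_mx1_nonneg R n 1) (const_mx1_neq0 R (Ordinal n_gt0) ord0).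
pose U : 'M_n := \matrix_(i, j) uu j i 0.
have UE (c : 'cV_n) A :
    y *m L A *m (U *m c) = \sum_j c j 0 *: (zz j *m col j A).
  have -> : U *m c = \sum_j c j 0 *: uu j.
    apply/colP=> i; rewrite mxE summxE; apply: eq_bigr => j _.
    by rewrite !mxE mulrC.
  rewrite mulmx_sumr; apply: eq_bigr => j _.
  by case: (zuP j) => _ _ _ zuEj; rewrite -scalemxAr zuEj -mulmxA -colE.
have colk (d : 'cV_m) k j :
    col j (d *m delta_mx 0 k : 'M_(m, n)) = (j == k)%:R *: d.
  apply/colP=> i; rewrite !mxE big_ord1 !mxE.
  by case: (j == k); rewrite ?mulr1 ?mulr0 ?mul1r ?mul0r.
(* Testing on matrices with a single nonzero column k isolates c k 0. *)
have UEk (c : 'cV_n) (d : 'cV_m) k :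
    y *m L (d *m delta_mx 0 k) *m (U *m c) = c k 0 *: (zz k *m d).
  rewrite UE (bigD1 k) //= colk eqxx scale1r big1 ?addr0 // => j /negPf jk.
  by rewrite colk jk scale0r mulmx0 scaler0.
have U_unit : U \in unitmx.
  rewrite -unitmx_tr -row_free_unit; apply: inj_row_free => c.
  move/(congr1 trmx); rewrite trmx_mul trmxK trmx0 => Uc.
  apply/rowP=> k; rewrite [RHS]mxE; apply/eqP.
  have [_ /rV0Pn[i zi] _ _] := zuP k.
  have := UEk c^T (delta_mx i 0) k.
  rewrite Uc mulmx0 -colE => /matrixP/(_ 0 0)/esym/eqP.
  by rewrite !mxE mulf_eq0 (negPf zi) orbF.
have [c zE] : exists c : 'cV_n, forall k, z = c k 0 *: zz k.
  exists (invmx U *m u) => k; set c := invmx U *m u.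
  apply/rowP=> i; have := UEk c (delta_mx i 0) k.
  rewrite mulKVmx // zuE => /matrixP/(_ 0 0).
  rewrite -mulmxA -[_ *m _ *m const_mx 1]mulmxA.
  have -> : delta_mx 0 k *m const_mx 1 = 1%:M :> 'M[R]_1.
    by rewrite -rowE; apply/matrixP=> a b; rewrite !ord1 !mxE eqxx.
  by rewrite mulmx1 -!colE !mxE.
have c_gt0 k : 0 < c k 0.
  have [zk_ge0 _ _ _] := zuP k.
  have [i zi] := rV0Pn _ z_neq0.
  apply: (pos_factor (zk_ge0 0 i)).
  by have := z_ge0 0 i; rewrite lt_def; move: zi; rewrite (zE k) mxE => -> ->.
exists z, (U *m diag_mx c^T); split=> //.
- move=> i j; rewrite mul_mx_diag !mxE mulr_ge0 //; last exact: ltW.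
  by have [_ _ uj_ge0 _] := zuP j; apply: uj_ge0.
- rewrite unitmx_mul U_unit /= unitmxE det_diag unitfE.
  by apply/prodf_neq0 => k _; rewrite mxE gt_eqF.
move=> A; apply: trmx_inj; apply/row_matrixP=> j; rewrite -!tr_col; congr (_^T).
have colV : col j (U *m diag_mx c^T) = c j 0 *: uu j.
  by apply/colP=> i; rewrite mxE mul_mx_diag !mxE mulrC.
have [_ _ _ zuEj] := zuP j.
rewrite colE -mulmxA -colE colV -scalemxAr zuEj -colE.
by rewrite [in RHS](zE j) -scalemxAl linearZ.
Qed.

(** * The preservers *)

Theorem theorem3p11 (R : realType) (m n : nat) (hn : (2 <= n)%N)
    (hmn : (n <= m)%N)
    (L : {linear 'M[R]_(m, n) -> 'M[R]_(m, n)})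
    (L_inv : bijective L)
    (L_semipos : forall A : 'M[R]_(m, n), semipositive A -> semipositive (L A)) :
  exists (X : 'M[R]_m) (Y : 'M[R]_n),
    [/\ X \in unitmx, row_positive X, inverse_nonnegative Y
      & forall A : 'M[R]_(m, n), L A = X *m A *m Y].
Proof.
have n_gt0 : (0 < n)%N by exact: leq_trans hn.
pose j0 := Ordinal n_gt0.
have m_gt0 : (0 < m)%N by exact: leq_trans hmn.
have /fin_all_exists[zz /fin_all_exists[VV zVP]] i :=
  column_pullback L_inv L_semipos
    (delta_mx_nonneg R ord0 i) (delta_mx_neq0 R ord0 i) n_gt0.
have [z [V [z_ge0 z_neq0 V_ge0 V_unit zVE]]] :=
  column_pullback L_inv L_semipos (@const_mx1_nonneg R 1 m)
    (const_mx1_neq0 R ord0 (Ordinal m_gt0)) n_gt0.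
pose Z : 'M_m := \matrix_i zz i.
have rowL i A : row i (L A) = zz i *m A *m invmx (VV i).
  by have [_ _ _ Vi_unit <-] := zVP i; rewrite mulmxK // rowE.
(* A vector c in the right kernel of Z would give L (c *m e_0) = 0. *)
have Z_unit : Z \in unitmx.
  rewrite -unitmx_tr -row_free_unit; apply: inj_row_free => c.
  move/(congr1 trmx); rewrite trmx_mul trmxK trmx0 => Zc.
  have Lc0 : L (c^T *m delta_mx 0 j0) = 0.
    apply/row_matrixP=> i; rewrite rowL row0 mulmxA.
    by rewrite -[zz i](rowK zz) -row_mul Zc row0 !mul0mx.
  have := bij_inj L_inv (etrans Lc0 (esym (linear0 L))).
  move/matrixP=> c0; apply/rowP=> i; have := c0 i j0.
  by rewrite !mxE big_ord1 !mxE !eqxx mulr1.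
have zzZ k : zz k *m invmx Z = delta_mx 0 k.
  by rewrite -[zz k](rowK zz) -row_mul mulmxV // row1.
have sumL (A : 'M_(m, n)) :
    \sum_i zz i *m A *m invmx (VV i) = z *m A *m invmx V.
  rewrite -zVE mulmxK //.
  under eq_bigr => i _ do rewrite -rowL.
  apply/rowP=> j; rewrite summxE !mxE.
  by apply: eq_bigr => i _; rewrite !mxE mul1r.
pose a i : R := (z *m invmx Z) 0 i.
(* A matrix A = Z^-1 e_i e_j is killed by every row zz k except zz i. *)
have VE i : invmx (VV i) = a i *: invmx V.
  apply/row_matrixP=> j.
  have := sumL (invmx Z *m (delta_mx i 0 : 'cV_m) *m delta_mx 0 j).
  rewrite (bigD1 i) //= big1 => [|k /negPf ki].
    rewrite addr0 !mulmxA zzZ !mul_delta_mx -rowE => ->.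
    rewrite -colE [col i _]mx11_scalar mul_scalar_mx -scalemxAl -rowE mxE.
    by rewrite linearZ.
  by rewrite !mulmxA zzZ mul_delta_mx_cond ki mulr0n !mul0mx.
have aV i : V = a i *: VV i.
  have [_ _ _ Vi_unit _] := zVP i.
  by rewrite -[LHS](mulKVmx Vi_unit) VE -scalemxAl mulVmx // -scalemxAr mulmx1.
have a_gt0 i : 0 < a i.
  have [_ _ Vi_ge0 _ _] := zVP i.
  have /matrix0Pn[j [k Vjk]] : V != 0.
    apply: contraTneq V_unit => ->.
    by rewrite -row_free_unit /row_free mxrank0 eq_sym -lt0n.
  apply: (pos_factor (Vi_ge0 j k)).
  by have := V_ge0 j k; rewrite lt_def; move: Vjk; rewrite (aV i) mxE => -> ->.
exists (diag_mx (\row_i a i) *m Z), (invmx V).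
have X_unit : diag_mx (\row_i a i) *m Z \in unitmx.
  rewrite unitmx_mul Z_unit andbT unitmxE det_diag unitfE.
  by apply/prodf_neq0 => k _; rewrite mxE gt_eqF.
split=> //.
- split=> [i j|i].
    rewrite mul_diag_mx !mxE mulr_ge0 //; first exact: ltW.
    by have [zi_ge0 _ _ _ _] := zVP i; apply: zi_ge0.
  have [_ /rV0Pn[j zij] _ _ _] := zVP i; exists j.
  by rewrite mul_diag_mx !mxE mulf_neq0 // gt_eqF.
- by split; rewrite ?unitmx_inv ?invmxK.
move=> A; apply/row_matrixP=> i; rewrite rowL VE !row_mul row_diag_mx.
rewrite -[X in _ = X *m _ *m _]scalemxAl -rowE rowK mxE.
by rewrite -!scalemxAl -scalemxAr.
Qed.
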